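(* Let $G$ be a connected graph of order $n\geq 4$. Then (1) $sdiam_{n-2}(G)=n-3$ if and only if $\kappa(G)\geq 3$; (2) $sdiam_{n-2}(G)=n-2$ if and only if $\kappa(G)=2$ or $G$ contains exactly one cut vertex; (3) $sdiam_{n-2}(G)=n-1$ if and only if $G$ contains at least two cut vertices.
   Context: $\kappa(G)$ denotes the vertex connectivity of $G$ (with $\kappa(K_n)=n-1$). For $S\subseteq V(G)$, the Steiner distance $d_G(S)$ is the minimum number of edges of a connected subgraph of $G$ whose vertex set contains $S$. For $2\leq m\leq n$, the Steiner $m$-diameter is $sdiam_m(G)=\max\{d_G(S): S\subseteq V(G),\ |S|=m\}$. A cut vertex is a vertex whose removal disconnects $G$. *)

(* Defs.v *)
From mathcomp Require Import all_boot.

Set Implicit Arguments.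
Unset Strict Implicit.
Unset Printing Implicit Defensive.

Record sgraph := SGraph {
  vertex :> finType;
  adj : rel vertex;
  adj_sym : symmetric adj;
  adj_irrefl : irreflexive adj }.

Definition edge_set (G : sgraph) : {set {set G}} :=
  [set [set p.1; p.2] | p : G * G & adj p.1 p.2].

Section Subgraphs.

Variable G : sgraph.

(* A candidate subgraph is a pair (vertex set, edge set). *)
Definition is_subgraph (H : {set G} * {set {set G}}) : bool :=
  (H.2 \subset edge_set G) && [forall f in H.2, f \subset H.1].

(* The graph without vertices counts as connected, so the negation says
   exactly that two vertices of H are not joined by a path of H. *)
Definition connected (H : {set G} * {set {set G}}) : bool :=
  [forall x in H.1, forall y in H.1,
     connect [rel u v | [set u; v] \in H.2] x y].

Definition whole : {set G} * {set {set G}} := ([set: G], edge_set G).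

(* The induced subgraph G - X. *)
Definition delete (X : {set G}) : {set G} * {set {set G}} :=
  (~: X, [set f in edge_set G | f \subset ~: X]).

End Subgraphs.

Definition connected_graph (G : sgraph) : bool := connected (whole G).

Definition cut_vertices (G : sgraph) : {set G} :=
  [set v : G | ~~ connected (delete [set v])].

(* Every X with G - X disconnected has at most #|G| - 2 elements, so the base
   value of the minimum matters only when no such X exists, i.e. when G is
   complete. *)
Definition kappa (G : sgraph) : nat :=
  \big[minn/#|G|.-1]_(X : {set G} | ~~ connected (delete X)) #|X|.

(* For connected G the base value of the minimum is attained by H = whole G;
   for disconnected G the value is not meaningful. *)
Definition steiner_dist (G : sgraph) (S : {set G}) : nat :=
  \big[minn/#|edge_set G|]_(H : {set G} * {set {set G}}
    | [&& is_subgraph H, connected H & S \subset H.1]) #|H.2|.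

Definition sdiam (m : nat) (G : sgraph) : nat :=
  \max_(S : {set G} | #|S| == m) steiner_dist S.

(* Main.v *)
(* Sending each non-root vertex of a connected subgraph to the edge towards its
   breadth-first parent is injective, and the image is a spanning tree. Hence
   d(S) is the least #|W| - 1 over the sets W containing S that induce a
   connected subgraph. For #|S| = n - 2 the complement of W is one of the
   subsets of the pair X = V \ S: all of X gives n - 3, a single vertex n - 2,
   the empty set n - 1. So sdiam <= n - 3 iff no pair disconnects G, and
   sdiam <= n - 2 iff every pair contains a vertex that is not a cut vertex or
   has connected complement; two cut vertices always form a separating pair,
   so the second alternative adds nothing. *)
Require Import Defs.
From mathcomp Require Import all_boot zify.

(** * Minima with a base value *)

Lemma bigminn_leq (I : Type) (r : seq I) (P : pred I) (F : I -> nat) b k :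
  (\big[minn/b]_(i <- r | P i) F i <= k) =
  (b <= k) || has (fun i => P i && (F i <= k)) r.
Proof.
elim: r => [|i r IHr]; first by rewrite big_nil orbF.
rewrite big_cons /=; case: (P i) => //=.
by rewrite geq_min IHr orbCA.
Qed.

Lemma bigminn_leqP (I : finType) (P : pred I) (F : I -> nat) b k :
  reflect (b <= k \/ exists2 i, P i & F i <= k)
          (\big[minn/b]_(i | P i) F i <= k).
Proof.
rewrite bigminn_leq; apply: (iffP orP) => -[->|]; try by left.
- by case/hasP => i _ /andP[Pi Fi]; right; exists i.
- by case=> i Pi Fi; right; apply/hasP; exists i; rewrite ?mem_index_enum ?Pi.
Qed.

(** [d v] is the length of a shortest walk from [r] to [v], and [p v] is the last vertex before [v]
    on such a walk. *)
Lemma parent_function (T : finType) (e : rel T) (r : T) :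
  exists p : T -> T, exists d : T -> nat, forall v, connect e r v -> v != r ->
    [/\ connect e r (p v), e (p v) v & d (p v) < d v].
Proof.
pose walk k v := [exists q : k.-tuple T, path e r q && (last r q == v)].
have walkP k v :
    reflect (exists q, [/\ path e r q, last r q = v & size q = k]) (walk k v).
  apply: (iffP existsP) => [[q /andP[eq /eqP lq]]|[q [eq lq sq]]].
    by exists q; rewrite size_tuple.
  by exists (tcast sq (in_tuple q)); rewrite val_tcast /= eq lq eqxx.
(* Reachability sits under the existential so that [fin_all_exists] gives a total function;
   unreachable vertices get the dummy value 0. *)
have dP v : exists k, connect e r v -> walk k v /\ forall j, walk j v -> k <= j.
  case: (boolP (connect e r v)) => [/connectP[q eq lq]|_]; last by exists 0.
  have ex : exists k, walk k v by exists (size q); apply/walkP; exists q.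
  by case: (ex_minnP ex) => k wk mk; exists k.
have {dP} [d dP] := fin_all_exists dP.
have pP v : exists u, connect e r v -> v != r ->
    [/\ connect e r u, e u v & d u < d v].
  case: (boolP (connect e r v)) => [rv|_]; last by exists r.
  case: (eqVneq v r) => [|vr]; first by exists r.
  have [/walkP[q [eq lq sq]] _] := dP v rv.
  case: (lastP q) eq lq sq => [|q' w]; first by move=> _ /= rv'; rewrite rv' eqxx in vr.
  rewrite rcons_path last_rcons size_rcons => /andP[eq' ew] wv sq.
  rewrite {w}wv in ew.
  (* Without its last step, the shortest walk to [v] still reaches the predecessor, which is
     therefore strictly closer to [r]. *)
  have ru : connect e r (last r q') by apply/connectP; exists q'.
  exists (last r q') => _ _; split=> //.
  by rewrite -sq ltnS; apply: (dP _ ru).2; apply/walkP; exists q'.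
by have [p] := fin_all_exists pP; exists p, d.
Qed.

Section Graph.

Variable G : sgraph.
Implicit Types (X Y S W : {set G}) (E : {set {set G}}).

(** * Edges and spanning trees *)

Definition edge_rel E : rel G := [rel u v | [set u; v] \in E].

Lemma edge_rel_sym E : symmetric (edge_rel E).
Proof. by move=> u v; rewrite /edge_rel /= setUC. Qed.

Lemma connectedP W E :
  reflect {in W &, forall x y, connect (edge_rel E) x y} (connected (W, E)).
Proof.
apply: (iffP forall_inP) => [cH x y xW yW|cH x xW].
  by have /forall_inP := cH x xW; apply.
by apply/forall_inP => y yW; apply: cH.
Qed.

Lemma edge_setE u v : ([set u; v] \in edge_set G) = adj u v.
Proof.
apply/imsetP/idP => [[[a b]]|uv]; last by exists (u, v); rewrite ?inE.
rewrite inE /= => ab uvE.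
have uab : u \in [set a; b] by rewrite -uvE set21.
have vab : v \in [set a; b] by rewrite -uvE set22.
have aneb : a != b by apply: contraTneq ab => ->; rewrite adj_irrefl.
have auv : a \in [set u; v] by rewrite uvE set21.
have buv : b \in [set u; v] by rewrite uvE set22.
rewrite !inE in uab vab auv buv.
(* The two cases with [u = v] force [a = b], which the absence of loops excludes. *)
case/orP: uab auv buv => /eqP->; case/orP: vab => /eqP-> //.
- by move=> _; rewrite orbb eq_sym (negbTE aneb).
- by rewrite adj_sym.
- by rewrite orbb (negbTE aneb).
Qed.

Lemma subset_edge E W x y :
  is_subgraph (W, E) -> edge_rel E x y -> (x \in W) && (y \in W).
Proof.
case/andP=> _ /forall_inP sW /sW /=.
by rewrite subUset !sub1set.
Qed.

Lemma connected_card W E :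
  is_subgraph (W, E) -> connected (W, E) -> #|W| <= #|E|.+1.
Proof.
move=> sH /connectedP cH; case: (set_0Vmem W) => [->|[r rW]].
  by rewrite cards0.
have [p [d pP]] := parent_function _ (edge_rel E) r.
have {}pP v : v \in W :\ r -> edge_rel E (p v) v /\ d (p v) < d v.
  by case/setD1P=> vr vW; have [] := pP v (cH _ _ rW vW) vr.
rewrite (cardsD1 r) rW add1n ltnS.
rewrite -(card_in_imset (f := fun v => [set p v; v])).
  apply/subset_leq_card/subsetP => _ /imsetP[v vW ->].
  by have [] := pP v vW.
(* If distinct [v] and [w] had the same parent edge, each would be the parent of the other, and [d]
   would decrease in both directions. *)
move=> v w vW wW vwE; apply/eqP; apply: contraT => vw.
have : v \in [set p w; w] by rewrite -vwE set22.
have : w \in [set p v; v] by rewrite vwE set22.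
rewrite !inE (eq_sym w v) (negbTE vw) !orbF => /eqP wE /eqP vE.
have [_ dv] := pP v vW; have [_ dw] := pP w wW.
by move: dv dw; rewrite -wE -vE => dv /(ltn_trans dv); rewrite ltnn.
Qed.

(** The parent edges form the tree: following parents strictly lowers [d], so every vertex of [W] is
    joined to the root. *)
Lemma spanning_tree W E : is_subgraph (W, E) -> connected (W, E) ->
  exists F : {set {set G}}, [/\ F \subset E, connected (W, F) & #|F| <= #|W|.-1].
Proof.
move=> sH /connectedP cH; case: (set_0Vmem W) => [->|[r rW]].
  exists set0; rewrite sub0set cards0; split=> //.
  by apply/connectedP=> x y; rewrite inE.
have [p [d pP]] := parent_function _ (edge_rel E) r.
pose F := [set [set p v; v] | v in W :\ r]; exists F; split.
- apply/subsetP => _ /imsetP[v /setD1P[vr vW] ->].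
  by have [] := pP v (cH _ _ rW vW) vr.
- suff rF v : v \in W -> connect (edge_rel F) r v.
    apply/connectedP => x y xW yW; apply: connect_trans (rF y yW).
    by rewrite (sym_connect_sym (edge_rel_sym F)) rF.
  have [k] := ubnP (d v); elim: k v => // k IHk v dv vW.
  case: (eqVneq v r) => [->|vr]; first exact: connect0.
  have [_ epv dpv] := pP v (cH _ _ rW vW) vr.
  have /andP[pW _] := subset_edge _ _ _ _ sH epv.
  apply: connect_trans (IHk _ (leq_trans dpv dv) pW) (connect1 _).
  by apply/imsetP; exists v; rewrite ?in_setD1 ?vr.
- by rewrite (cardsD1 r W) rW; apply: leq_imset_card.
Qed.

(** * Steiner distance in terms of deleted vertex sets *)

Lemma delete_subgraph X : is_subgraph (delete X).
Proof.
rewrite /is_subgraph /=; apply/andP; split.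
  by apply/subsetP=> f; rewrite inE => /andP[].
by apply/forall_inP=> f; rewrite inE => /andP[].
Qed.

Lemma delete_edge X u v :
  edge_rel (delete X).2 u v = [&& adj u v, u \notin X & v \notin X].
Proof. by rewrite /edge_rel /= inE edge_setE subUset !sub1set !inE. Qed.

Lemma connected_deleteP X :
  reflect {in ~: X &, forall x y, connect (edge_rel (delete X).2) x y}
          (connected (delete X)).
Proof. exact: connectedP. Qed.

Lemma delete0 : delete set0 = whole G.
Proof.
congr (_, _); rewrite ?setC0 //.
by apply/setP=> f; rewrite inE subsetT andbT.
Qed.

Lemma subgraph_connected_delete W E :
  is_subgraph (W, E) -> connected (W, E) -> connected (delete (~: W)).
Proof.
move=> sH /connectedP cH; apply/connected_deleteP=> x y.
rewrite setCK => xW yW; apply: connect_sub (cH x y xW yW) => u v uv.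
apply: connect1; rewrite delete_edge !inE !negbK (subset_edge _ _ _ _ sH uv).
rewrite andbT -edge_setE; case/andP: sH => /subsetP sE _; exact: sE.
Qed.

(** [Y] is the complement of the vertex set of a connected subgraph containing [S]. Such a subgraph
    has at least [#|G| - #|Y| - 1] edges, and a spanning tree of [delete Y] has no more than
    that. *)
Lemma steiner_dist_leqP S k : connected_graph G ->
  reflect (exists Y, [/\ Y \subset ~: S, connected (delete Y)
                       & #|G| - #|Y| <= k.+1])
          (steiner_dist S <= k).
Proof.
move=> cG.
have toY H : is_subgraph H -> connected H -> S \subset H.1 -> #|H.2| <= k ->
    exists Y, [/\ Y \subset ~: S, connected (delete Y) & #|G| - #|Y| <= k.+1].
  case: H => W E sH cH SW Ek; exists (~: W); split.
  - by rewrite setCS.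
  - exact: subgraph_connected_delete cH.
  - rewrite cardsCs setCK subKn ?max_card //.
    by apply: leq_trans (connected_card _ _ sH cH) _.
apply: (iffP (bigminn_leqP _ _ _ _ _)) => [[Ek|[H /and3P[sH cH SH] Ek]]|].
(* The base value of the minimum is the edge count of [whole G], itself an admissible subgraph as
   [G] is connected. *)
- apply: (toY (whole G)) => //; last exact: subsetT.
  by rewrite -delete0 delete_subgraph.
- exact: toY H sH cH SH Ek.
- case=> Y [YS cY Yk]; right.
  have [F [FE cF Fk]] := spanning_tree _ _ (delete_subgraph Y) cY.
  exists (~: Y, F).
    rewrite cF /= subsetC YS andbT.
    case/andP: (delete_subgraph Y) => /= sE /forall_inP sW.
    rewrite /is_subgraph (subset_trans FE sE) /=; apply/forall_inP=> f fF.
    by apply: sW; apply: (subsetP FE).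
  apply: leq_trans Fk _; rewrite /= cardsCs setCK.
  by move: Yk; case: (_ - _).
Qed.

(** [X] runs over the complements of the [m]-sets [S]. *)
Lemma sdiam_leqP m k : connected_graph G -> m <= #|G| ->
  reflect (forall X, #|X| = #|G| - m -> exists Y,
             [/\ Y \subset X, connected (delete Y) & #|G| - #|Y| <= k.+1])
          (sdiam m G <= k).
Proof.
move=> cG mG; apply: (iffP (bigmax_leqP _ _ _)) => [dS X Xm|dX S /eqP Sm].
  have /(steiner_dist_leqP _ _ cG) : steiner_dist (~: X) <= k.
    by apply: dS; rewrite cardsCs setCK Xm subKn.
  by rewrite setCK.
by apply/steiner_dist_leqP => //; apply: dX; rewrite cardsCs setCK Sm.
Qed.

Lemma sdiam_geq m : connected_graph G -> m <= #|G| -> m <= (sdiam m G).+1.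
Proof.
move=> cG mG; have /card_geqP[s [us sm _]] : #|G| - m <= #|[set: G]|.
  by rewrite cardsT leq_subr.
have cs : #|[set x in s]| = #|G| - m by rewrite cardsE (card_uniqP us).
have [Y [YX _]] := elimT (sdiam_leqP m _ cG mG) (leqnn _) _ cs.
apply: leq_trans; rewrite -{1}(subKn mG) leq_sub2l // -cs.
exact: subset_leq_card.
Qed.

(** * Separating sets and connectivity *)

Lemma disconnected_delete_sub X X' x y : X \subset X' ->
  x \notin X' -> y \notin X' -> ~~ connect (edge_rel (delete X).2) x y ->
  ~~ connected (delete X').
Proof.
move=> XX' xX yX; apply: contra => /connected_deleteP cX'.
have := cX' x y; rewrite !inE => /(_ xX yX).
apply: connect_sub => u v; rewrite delete_edge => /and3P[uv uX vX].
apply: connect1; rewrite delete_edge uv.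
by rewrite !(contra (subsetP XX' _)).
Qed.

Lemma delete_disconnectedP X :
  reflect (exists x y, [/\ x \notin X, y \notin X
                         & ~~ connect (edge_rel (delete X).2) x y])
          (~~ connected (delete X)).
Proof.
apply: (iffP idP) => [|[x [y [xX yX nxy]]]].
  case/forall_inPn=> x xX /forall_inPn[y yX nxy]; exists x, y.
  by rewrite -!in_setC.
exact: disconnected_delete_sub nxy.
Qed.

(** A separating set can be enlarged one vertex at a time while two separated vertices [x] and [y]
    are kept; the bound on [#|G|] leaves room for them. *)
Lemma disconnected_delete_card X k : ~~ connected (delete X) ->
  #|X| <= k -> k.+2 <= #|G| ->
  exists2 X' : {set G}, #|X'| = k & ~~ connected (delete X').
Proof.
have [j] := ubnP (k - #|X|); elim: j X => // j IHj X jX nX Xk kG.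
move: Xk; rewrite leq_eqVlt => /orP[/eqP|] Xk; first by exists X.
have /delete_disconnectedP[x [y [xX yX nxy]]] := nX.
(* [X] has fewer than [k] elements, so together with [x] and [y] it does not fill [G]. *)
have [z zX] : exists z, z \notin [set x; y] :|: X.
  apply/existsP; rewrite -negb_forall; apply/negP => /forallP aX.
  have : #|G| <= #|[set x; y]| + #|X|.
    apply: leq_trans (leq_card_setU _ _); rewrite -cardsT.
    by apply/subset_leq_card/subsetP => z _.
  apply/negP; rewrite -ltnNge; apply: leq_trans kG.
  by rewrite cards2 addSn ltnS; case: (x != y); rewrite ?add1n ?add0n // ltnW.
move: zX; rewrite !inE !negb_or => /andP[/andP[zx zy] zX].
have sz : #|z |: X| = #|X|.+1 by rewrite cardsU1 zX.
apply: (IHj (z |: X)); rewrite ?sz //.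
  by move: jX; rewrite -(subnSK Xk).
apply: disconnected_delete_sub nxy; first exact: subsetUr.
  by rewrite !inE negb_or eq_sym zx.
by rewrite !inE negb_or eq_sym zy.
Qed.

Lemma kappa_leqP k : k.+2 <= #|G| ->
  reflect (exists2 X : {set G}, #|X| = k & ~~ connected (delete X)) (kappa G <= k).
Proof.
move=> kG; apply: (iffP (bigminn_leqP _ _ _ _ _)) => [[|[X nX Xk]]|[X <- nX]].
(* The base value [#|G|.-1] exceeds [k], so the bound must come from a separating set. *)
- by rewrite leqNgt ltn_predRL kG.
- exact: disconnected_delete_card nX Xk kG.
- by right; exists X.
Qed.

Lemma cut_vertices_neq0 : 3 <= #|G| -> (0 < #|cut_vertices G|) = (kappa G <= 1).
Proof.
move=> G3; apply/card_gt0P/(kappa_leqP _ G3) => [[v]|[X /eqP/cards1P[v ->] nv]].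
  by rewrite inE => nv; exists [set v]; rewrite ?cards1.
by exists v; rewrite inE.
Qed.

(** * Pairs of cut vertices *)

(** A neighbour [y] of [v] other than [u] would attach [v] to the connected rest, making the graph
    without [u] connected. *)
Lemma delete1_connected_adj (u v y : G) : u != v -> y != u -> y != v ->
  ~~ connected (delete [set u]) -> connected (delete [set u; v]) -> ~~ adj v y.
Proof.
move=> uv yu yv /delete_disconnectedP[a [b [au bu nab]]] cuv.
have sub x z : x \notin [set u; v] -> z \notin [set u; v] ->
    connect (edge_rel (delete [set u]).2) x z.
  move=> xX zX; apply: contraT => nxz; move: cuv; apply: contraTT => _.
  by apply: disconnected_delete_sub nxz => //; apply: subsetUl.
apply: contra nab => vy.
suff con x : x \notin [set u] -> connect (edge_rel (delete [set u]).2) y x.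
  apply: connect_trans (con b bu).
  by rewrite (sym_connect_sym (edge_rel_sym _)) con.
rewrite inE => xu; case: (eqVneq x v) => [->|xv].
  by apply: connect1; rewrite delete_edge !inE yu (eq_sym v) uv adj_sym vy.
by apply: sub; rewrite !inE negb_or ?yu ?xu.
Qed.

(** Otherwise neither [u] nor [v] has a neighbour outside the pair, so no path leaves the pair,
    although [G] is connected and has a third vertex. *)
Lemma delete2_cut_vertices u v : connected_graph G -> 3 <= #|G| -> u != v ->
  u \in cut_vertices G -> v \in cut_vertices G ->
  ~~ connected (delete [set u; v]).
Proof.
move=> cG G3 uv; rewrite !inE => nu nv; apply/negP=> cuv.
have vu : v != u by rewrite eq_sym.
have cvu : connected (delete [set v; u]) by rewrite setUC.
have [y yX] : exists y, y \in ~: [set u; v].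
  by apply/card_gt0P; rewrite cardsCs setCK cards2 uv subn_gt0.
have clX : closed (edge_rel (edge_set G)) (mem [set u; v]).
  apply: intro_closed => [|a b].
    exact: sym_connect_sym (edge_rel_sym _).
  rewrite /edge_rel /= edge_setE => ab; rewrite !inE.
  case/orP=> /eqP aE; rewrite {a}aE in ab; apply: contraTT ab;
    rewrite negb_or => /andP[bu bv].
    exact: delete1_connected_adj vu bv bu nv cvu.
  exact: delete1_connected_adj uv bu bv nu cuv.
have := closed_connect clX (connectedP _ _ cG u y (in_setT _) (in_setT _)).
by move: yX; rewrite !inE eqxx => /negbTE->.
Qed.

(** * The thresholds of the Steiner diameter *)

Lemma sdiam_leq_kappa : connected_graph G -> 4 <= #|G| ->
  (sdiam (#|G| - 2) G <= #|G| - 3) = (3 <= kappa G).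
Proof.
move=> cG G4; have G3 : 3 <= #|G| by apply: ltnW.
have G2 : 2 <= #|G| by apply: ltnW.
apply/(sdiam_leqP _ _ cG (leq_subr _ _))/idP; rewrite subKn //.
  move=> dX; rewrite ltnNge; apply/(kappa_leqP _ G4) => -[X X2].
  have [Y [YX cY Yn]] := dX X X2.
  (* The bound says that [Y] has at least two elements, so it is all of the pair [X]. *)
  suff /eqP <- : Y == X by rewrite cY.
  rewrite eqEcard YX X2; move: Yn.
  by rewrite subnSK // leq_subCl subKn.
move=> k3 X X2; exists X; rewrite X2 subnSK //; split=> //.
apply: contraTT k3 => nX; rewrite -leqNgt; apply/kappa_leqP => //.
by exists X.
Qed.

Lemma sdiam_leq_cut_vertices : connected_graph G -> 4 <= #|G| ->
  (sdiam (#|G| - 2) G <= #|G| - 2) = (#|cut_vertices G| <= 1).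
Proof.
move=> cG G4; have G3 : 3 <= #|G| by apply: ltnW.
have G2 : 2 <= #|G| by apply: ltnW.
apply/(sdiam_leqP _ _ cG (leq_subr _ _))/idP; rewrite subKn //.
  move=> dX; rewrite leqNgt; apply/card_gt1P => -[u [v [uC vC uv]]].
  have [|Y [YX cY]] := dX [set u; v]; first by rewrite cards2 uv.
  (* Here the bound only says that [Y] is nonempty: it is the whole pair, which separates [G], or a
     single cut vertex. *)
  rewrite subnSK // leq_subCl subKn ?(ltnW G2) // => Y1.
  have nuv := delete2_cut_vertices _ _ cG G3 uv uC vC.
  have := subset_leq_card YX; rewrite cards2 uv leq_eqVlt => /orP[/eqP Y2|].
    suff YE : Y = [set u; v] by rewrite YE (negbTE nuv) in cY.
    by apply/eqP; rewrite eqEcard YX cards2 uv Y2.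
  rewrite ltnS => Y_le1; have /cards1P[w YE] : #|Y| == 1 by rewrite eqn_leq Y_le1.
  have : w \in cut_vertices G.
    by move: YX; rewrite YE sub1set => /set2P[]->.
  by rewrite inE -YE cY.
move=> C1 X X2.
(* A pair cannot fit into a set of at most one cut vertex; deleting [y] alone then suffices. *)
have [y yX yC] : exists2 y, y \in X & y \notin cut_vertices G.
  have : ~~ (X \subset cut_vertices G).
    by apply: contraL C1 => /subset_leq_card; rewrite X2 -ltnNge.
  by case/subsetPn=> y; exists y.
exists [set y]; rewrite sub1set cards1 subnSK //; split=> //.
by move: yC; rewrite inE negbK.
Qed.

Lemma sdiam_leq_pred : connected_graph G -> 2 <= #|G| ->
  sdiam (#|G| - 2) G <= #|G| - 1.
Proof.
move=> cG G2; apply/(sdiam_leqP _ _ cG (leq_subr _ _)) => X _.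
exists set0; rewrite sub0set delete0 cards0 subn0 subn1 prednK //.
exact: ltnW.
Qed.

Lemma kappa_gt0 : connected_graph G -> 2 <= #|G| -> 0 < kappa G.
Proof.
move=> cG G2; rewrite ltnNge; apply/(kappa_leqP _ G2) => -[X /eqP].
by rewrite cards_eq0 => /eqP->; rewrite delete0 [connected _]cG.
Qed.

End Graph.

Theorem theorem2 (G : sgraph) (n : nat) (hG : connected_graph G)
  (hn : #|G| = n) (hn4 : 4 <= n) :
  (sdiam (n - 2) G = n - 3 <-> 3 <= kappa G) /\
  (sdiam (n - 2) G = n - 2 <-> kappa G = 2 \/ #|cut_vertices G| = 1) /\
  (sdiam (n - 2) G = n - 1 <-> 2 <= #|cut_vertices G|).
Proof.
rewrite -{n}hn in hn4 *.
have := sdiam_geq _ _ hG (leq_subr 2 _).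
have := sdiam_leq_pred _ hG (leq_trans _ hn4) => /(_ isT).
have := sdiam_leq_kappa _ hG hn4.
have := sdiam_leq_cut_vertices _ hG hn4.
have := cut_vertices_neq0 _ (ltnW hn4).
have := kappa_gt0 _ hG (leq_trans _ hn4) => /(_ isT).
(* Only arithmetic remains: [s] lies between [n - 3] and [n - 1], the thresholds are [3 <= k] and
   [c <= 1], and [c = 0] exactly when [k >= 2]. Hence the middle value splits into [c = 0] with
   [k = 2], and [c = 1]. *)
move: (sdiam _ _) (kappa G) #|cut_vertices G| => s k c.
lia.
Qed.
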